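(* Let $h\in L^2(\Omega)$, $f\in L^\infty(0,\tau;L^2(\Omega))$, and let $g\in L^2(\Omega)$ be the unique solution of $Tg=\Upsilon_{h,f}$. If $g\in S_{\varrho,p}$ for some $\varrho,p>0$, then there exists a constant $C_3>0$, depending only on $\alpha,\tau,\lambda_1$ and $C_1$, such that $$\|g\|\le C_3^{p/(p+2)}\,\|g\|_{H_p}^{2/(p+2)}\,\|\Upsilon_{h,f}\|^{p/(p+2)}.$$
   Context: Setting: $d\in\{1,\dots,7\}$, $\Omega\subset\mathbb R^d$ is a bounded domain with sufficiently smooth boundary, $\tau>0$, $\alpha\in(0,1)$; $\|\cdot\|$ and $\langle\cdot,\cdot\rangle$ are the norm and inner product of $L^2(\Omega)$. $0<\lambda_1<\lambda_2\le\cdots\to\infty$ are the Dirichlet eigenvalues of $-\Delta$ on $\Omega$ with eigenfunctions $\varphi_n\in H_0^1(\Omega)\cap H^2(\Omega)$ forming an orthonormal basis of $L^2(\Omega)$; $w_n=\langle w,\varphi_n\rangle$ for $w\in L^2(\Omega)$, and $z_n(s)=\langle z(s),\varphi_n\rangle$ for $z\in L^\infty(0,\tau;L^2(\Omega))$. Mittag-Leffler function: $E_{\gamma,b}(z)=\sum_{k=0}^\infty z^k/\Gamma(k\gamma+b)$. $C_1>0$ is a fixed constant with $\frac{C_1}{\Gamma(1-\alpha)}\frac1{1-x}\le E_{\alpha,1}(x)$ for all $x\le0$ (known to exist). $\Psi_f^{\alpha,n}(t)=\int_0^t(t-s)^{\alpha-1}E_{\alpha,\alpha}(-\lambda_n^2(t-s)^\alpha)f_n(s)\,ds$,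 $\Upsilon_{h,f}^{\alpha,n}=h_n-\Psi_f^{\alpha,n}(\tau)$, $\Upsilon_{h,f}=\sum_n\Upsilon_{h,f}^{\alpha,n}\varphi_n\in L^2(\Omega)$. The operator $T:L^2(\Omega)\to L^2(\Omega)$ is $T\phi=\sum_nE_{\alpha,1}(-\lambda_n^2\tau^\alpha)\langle\phi,\varphi_n\rangle\varphi_n$. $H_p=\{\phi\in L^2(\Omega):\sum_n\lambda_n^{2p}|\langle\phi,\varphi_n\rangle|^2<\infty\}$, $\|\phi\|_{H_p}^2=\sum_n\lambda_n^{2p}|\langle\phi,\varphi_n\rangle|^2$, and $S_{\varrho,p}=\{\phi\in H_p:\|\phi\|_{H_p}\le\varrho\}$. *)

(* Defs.v *)
From HB Require Import structures.
From mathcomp Require Import all_boot all_order all_algebra.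
From mathcomp Require Import all_classical all_reals all_analysis.

Set Implicit Arguments.
Unset Strict Implicit.
Unset Printing Implicit Defensive.

Import Order.TTheory GRing.Theory Num.Theory.
Import numFieldNormedType.Exports.

Local Open Scope classical_set_scope.
Local Open Scope ring_scope.

Definition rV_display : measure_display. Proof. exact. Qed.

(* The product (= Borel) sigma-algebra, generated by the coordinate maps. *)
Section rV_measurable.
Context (R : realType) (d : nat).

Let coors : 'I_d -> 'rV[R]_d -> R := fun i x => x ord0 i.

Let rV_set0 : g_sigma_preimage coors set0.
Proof. exact: sigma_algebra0. Qed.

Let rV_setC A : g_sigma_preimage coors A -> g_sigma_preimage coors (~` A).
Proof. exact: sigma_algebraC. Qed.

Let rV_bigcup (F : _^nat) : (forall i, g_sigma_preimage coors (F i)) ->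
  g_sigma_preimage coors (\bigcup_i (F i)).
Proof. exact: sigma_algebra_bigcup. Qed.

HB.instance Definition _ := @isMeasurable.Build rV_display
  'rV[R]_d (g_sigma_preimage coors) rV_set0 rV_setC rV_bigcup.

Lemma measurable_coord (i : 'I_d) :
  measurable_fun [set: 'rV[R]_d] (fun x : 'rV[R]_d => x ord0 i).
Proof.
move=> _ Y mY; rewrite setTI; apply: sub_sigma_algebra => /=.
rewrite -bigcup_seq/=; exists i => /=; first by rewrite mem_index_enum.
by exists Y => //; rewrite setTI.
Qed.

Lemma measurable_fun_rVP d1 (T1 : measurableType d1) (f : T1 -> 'rV[R]_d) :
  (forall i, measurable_fun [set: T1] (fun x => f x ord0 i)) ->
  measurable_fun [set: T1] f.
Proof.
move=> mf _ A mA; rewrite setTI; move: A mA.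
pose G := [set A : set 'rV[R]_d | measurable (f @^-1` A)].
suff : g_sigma_preimage coors `<=` G by [].
apply: smallest_sub.
  split.
  - by rewrite /G/= preimage_set0.
  - move=> A; rewrite /G/= setTD preimage_setC; exact: measurableC.
  - by move=> F mF; rewrite /G/= preimage_bigcup; apply: bigcup_measurable => k _; exact: mF.
rewrite -bigcup_seq/=; apply: bigcup_sub => i _ A [B mB <-].
by rewrite /G/= setTI; have := mf i measurableT _ mB; rewrite setTI.
Qed.

Lemma open_measurable_rV (A : set 'rV[R]_d) : open A -> measurable A.
Proof.
move=> oA.
pose B (q : 'rV[rat]_d) (k : nat) : set 'rV[R]_d :=
  [set y | forall i, ball (ratr (q ord0 i) : R) k.+1%:R^-1 (y ord0 i)].
have mB q k : measurable (B q k).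
  rewrite (_ : B q k = \bigcap_(i in [set: 'I_d])
      ((fun x : 'rV[R]_d => x ord0 i) @^-1`
         ball (ratr (q ord0 i) : R) k.+1%:R^-1)); last first.
    by apply/seteqP; split => y By i; [move=> _|]; exact: By.
  apply: fin_bigcap_measurable; first exact: finite_finset.
  move=> i _; rewrite -[X in measurable X]setTI; apply: measurable_coord => //.
  by rewrite ball_itv; exact: measurable_itv.
pose J := [set qk : 'rV[rat]_d * nat | B qk.1 qk.2 `<=` A].
rewrite (_ : A = \bigcup_(qk in J) B qk.1 qk.2).
  rewrite bigcup_mkcond; apply: countable_bigcupT_measurable => //= qk.
  by case: ifP.
apply/seteqP; split; last by move=> x [qk /= Jqk]; exact: Jqk.
move=> x Ax.
have /nbhs_ballP[e /= e0 xeA] : nbhs x A by exact: open_nbhs_nbhs.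
have [k ke] : exists k : nat, k.+1%:R^-1 < e / 2.
  have e20 : 0 < e / 2 by rewrite divr_gt0.
  have := near_infty_natSinv_lt (PosNum e20).
  by move=> [k _ /(_ k (leqnn k))/= ?]; exists k.
have /= /(_ _)/cid Hq (i : 'I_d) : exists q : rat, ball (ratr q : R) k.+1%:R^-1 (x ord0 i).
  have : x ord0 i - k.+1%:R^-1 < x ord0 i + k.+1%:R^-1.
    by rewrite ltrD2l gtrN// invr_gt0.
  move=> /rat_in_itvoo[q]; rewrite in_itv/= => /andP[q1 q2]; exists q.
  by rewrite /ball/= ltr_norml ltrBrDr addrC q1/= ltrBlDr addrC.
exists (\row_i sval (Hq i), k); last first.
  by move=> i /=; rewrite mxE; case: (Hq i).
move=> y /= By; apply: xeA; split=> // i j; rewrite (ord1 i).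
have := By j; rewrite mxE; case: (Hq j) => q /= hq hy.
apply: (@le_ball _ _ _ (k.+1%:R^-1 + k.+1%:R^-1)); first by rewrite [e]splitr lerD// ltW.
by apply: ball_triangle hy; exact: ball_sym.
Qed.
End rV_measurable.

Section lebesgue_rV.
Context (R : realType) (d : nat).

Definition rV_cons (p : 'rV[R]_d * R) : 'rV[R]_d.+1 :=
  \row_i if unlift ord0 i is Some j then p.1 ord0 j else p.2.

Lemma measurable_rV_cons : measurable_fun [set: 'rV[R]_d * R] rV_cons.
Proof.
apply: measurable_fun_rVP => i.
rewrite [X in measurable_fun _ X](_ : _ = fun p : 'rV[R]_d * R =>
    if unlift ord0 i is Some j then p.1 ord0 j else p.2); last first.
  by apply/funext => p; rewrite mxE.
case: unliftP => [j _|_]; last exact: measurable_snd.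
by apply: (measurableT_comp (@measurable_coord R d j)); exact: measurable_fst.
Qed.


Variable m : {measure set 'rV[R]_d -> \bar R}.

Definition lebesgue_cons : set 'rV[R]_d.+1 -> \bar R :=
  pushforward (m \x @lebesgue_measure R)%E rV_cons.

Let lebesgue_cons0 : lebesgue_cons set0 = 0%E.
Proof. by rewrite /lebesgue_cons /pushforward preimage_set0 measure0. Qed.

Let lebesgue_cons_ge0 A : (0 <= lebesgue_cons A)%E.
Proof. by rewrite /lebesgue_cons /pushforward; exact: measure_ge0. Qed.

Let lebesgue_cons_sigma_additive : semi_sigma_additive lebesgue_cons.
Proof.
have mpre A : measurable A -> measurable (rV_cons @^-1` A).
  by move=> mA; rewrite -[X in measurable X]setTI; exact: measurable_rV_cons.
move=> F mF tF mUF; rewrite /lebesgue_cons /pushforward preimage_bigcup.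
apply: measure_semi_sigma_additive => [n||].
- exact: mpre.
- apply/trivIsetP => /= i j _ _ ij; rewrite -preimage_setI.
  by move/trivIsetP : tF => /(_ _ _ _ _ ij) ->//; rewrite preimage_set0.
- by rewrite -preimage_bigcup; exact: mpre.
Qed.

HB.instance Definition _ := isMeasure.Build _ _ _ lebesgue_cons
  lebesgue_cons0 lebesgue_cons_ge0 lebesgue_cons_sigma_additive.

End lebesgue_rV.

(* The d-fold product of the one-dimensional Lebesgue measure. *)
Fixpoint lebesgue_rV (R : realType) (d : nat) :
    {measure set 'rV[R]_d -> \bar R} :=
  match d return {measure set 'rV[R]_d -> \bar R} with
  | 0 => \d_(0 : 'rV[R]_0)
  | d'.+1 => lebesgue_cons (lebesgue_rV R d')
  end.

Section smooth.
Context (R : realType) (d : nat).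
Implicit Types (v : 'rV[R]_d -> R) (A : set 'rV[R]_d).

Definition partial (i : 'I_d) v : 'rV[R]_d -> R := 'D_(delta_mx ord0 i) v.

Fixpoint Ck (m : nat) v : Prop :=
  continuous v /\
  if m is m'.+1 then
    forall i, (forall x, derivable v x (delta_mx ord0 i)) /\ Ck m' (partial i v)
  else True.

Definition test_function A v : Prop :=
  (forall m, Ck m v) /\
  exists K, [/\ compact K, K `<=` A & forall x, ~ K x -> v x = 0].

End smooth.

(* Near each boundary point, after singling out one coordinate and up to a
   reflection, the set is the strict epigraph of a C^m function. *)
Definition Ck_boundary (R : realType) (d m : nat) (A : set 'rV[R]_d) : Prop :=
  forall x0, (closure A `\` interior A) x0 ->
  exists (i : 'I_d) (b : bool) (gam : 'rV[R]_d.-1 -> R) (r : R),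
    [/\ 0 < r, Ck m gam &
        forall x, ball x0 r x ->
          (A x <-> 0 < (-1) ^+ b * (x ord0 i - gam (col' i x)))].

(* C^2 is the regularity under which the Dirichlet eigenfunctions belong to
   H^2(Omega). *)
Record smooth_domain (R : realType) (d : nat) := SmoothDomain {
  dom :> set 'rV[R]_d ;
  dom_nonempty : dom !=set0 ;
  dom_open : open dom ;
  dom_connected : connected dom ;
  dom_bounded : bounded_set dom ;
  dom_boundary : Ck_boundary 2 dom }.

Section L2.
Context (R : realType) (d : nat) (Omega : smooth_domain R d).

Definition dom_measure : {measure set 'rV[R]_d -> \bar R} :=
  mrestr (lebesgue_rV R d) (open_measurable_rV (dom_open (s := Omega))).

(* Elements of [L2] are square-integrable functions, not classes; equality in
   L^2(Omega) is [L2eq]. *)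
Definition L2 := LfunType dom_measure (lee1n 2).

Implicit Types (u v w : L2) (eta : 'rV[R]_d -> R).

Definition L2eq u v : Prop := (u : _ -> _) = v %[ae dom_measure].

Definition L2dot u v : R := \int[dom_measure]_x (u x * v x).

Definition L2norm u : R := fine ('N[dom_measure]_2%:E [EFin \o u])%E.

Definition L2cvg (s : nat -> L2) u : Prop :=
  L2norm (s k - u) @[k --> \oo] --> (0 : R).

Definition L2has_sum (s : nat -> L2) u : Prop :=
  L2cvg (fun N => \sum_(n < N) s n) u.

(* The sum of a series of L^2(Omega); 0 if the series diverges. *)
Definition L2sum (s : nat -> L2) : L2 := xget 0 [set u | L2has_sum s u].

Definition weak_partial (i : 'I_d) u v : Prop :=
  forall eta, test_function Omega eta ->
    \int[dom_measure]_x (u x * partial i eta x)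
    = - \int[dom_measure]_x (v x * eta x).

Definition H01 u : Prop :=
  exists G : 'I_d -> L2, (forall i, weak_partial i u (G i)) /\
  exists s : nat -> 'rV[R]_d -> R,
    [/\ forall k, test_function Omega (s k),
        Lnorm dom_measure 2%:E (fun x => (s k x - u x)%:E) @[k --> \oo]
          --> 0%E &
        forall i,
          Lnorm dom_measure 2%:E (fun x => (partial i (s k) x - G i x)%:E)
          @[k --> \oo] --> 0%E].

Definition weak_hessian u (H : 'I_d -> 'I_d -> L2) : Prop :=
  exists G : 'I_d -> L2, forall i,
    weak_partial i u (G i) /\ forall j, weak_partial j (G i) (H i j).

Definition H2 u : Prop := exists H, weak_hessian u H.

Definition weak_laplacian u w : Prop :=
  exists H, weak_hessian u H /\ L2eq w (\sum_i H i i).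

Definition orthonormal_basis (phi : nat -> L2) : Prop :=
  (forall m n, L2dot (phi m) (phi n) = (m == n)%:R) /\
  (forall u, L2has_sum (fun n => L2dot u (phi n) *: phi n) u).

(* Sequences are indexed from 0, so that [lam 0] is the first eigenvalue.
   Completeness of [phi] means that all eigenvalues are listed, with
   multiplicity. *)
Definition dirichlet_spectrum (lam : nat -> R) (phi : nat -> L2) : Prop :=
  [/\ 0 < lam 0%N, lam 0%N < lam 1%N,
      {homo lam : m n / (m <= n)%N >-> m <= n} &
      lam n @[n --> \oo] --> +oo] /\
  [/\ forall n, H01 (phi n), forall n, H2 (phi n),
      forall n, weak_laplacian (phi n) (- (lam n *: phi n)) &
      orthonormal_basis phi].

Definition L2simple (s : R -> L2) : Prop :=
  exists (m : nat) (A : 'I_m -> set R) (c : 'I_m -> L2),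
    (forall i, measurable (A i)) /\
    forall t, s t = \sum_(i < m) (\1_(A i) t : R) *: c i.

Definition strongly_measurable (D : set R) (f : R -> L2) : Prop :=
  exists s : nat -> R -> L2, (forall k, L2simple (s k)) /\
    {ae (@lebesgue_measure R), forall t, D t -> L2cvg (fun k => s k t) (f t)}.

Definition Linfty_L2 (tau : R) (f : R -> L2) : Prop :=
  strongly_measurable `]0, tau[ f /\
  exists M : R, {ae (@lebesgue_measure R),
    forall t, `]0, tau[%classic t -> L2norm (f t) <= M}.

End L2.

Section mittag_leffler.
Context (R : realType).

(* Euler's integral; only used at x > 0. *)
Definition Gamma (x : R) : R :=
  \int[lebesgue_measure]_(t in `]0, +oo[) (t `^ (x - 1) * expR (- t)).

Definition mittag_leffler (gam b z : R) : R :=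
  limn (series (fun k => z ^+ k / Gamma (k%:R * gam + b))).

End mittag_leffler.

Section problem.
Context (R : realType) (d : nat) (Omega : smooth_domain R d).
Variables (alpha tau : R) (lam : nat -> R) (phi : nat -> L2 Omega).
Implicit Types (g h u : L2 Omega) (f : R -> L2 Omega).

Definition Psi f (n : nat) (t : R) : R :=
  \int[lebesgue_measure]_(s in `[0, t])
    ((t - s) `^ (alpha - 1)
     * mittag_leffler alpha alpha (- (lam n) ^+ 2 * (t - s) `^ alpha)
     * L2dot (f s) (phi n)).

Definition Upsilon_coef h f (n : nat) : R :=
  L2dot h (phi n) - Psi f n tau.

Definition Upsilon h f : L2 Omega :=
  L2sum (fun n => Upsilon_coef h f n *: phi n).

Definition T_op u : L2 Omega :=
  L2sum (fun n => (mittag_leffler alpha 1 (- (lam n) ^+ 2 * tau `^ alpha)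
                   * L2dot u (phi n)) *: phi n).

Definition Hp_sqnorm (p : R) u : \bar R :=
  (\sum_(0 <= n <oo) (lam n `^ (2 * p) * `|L2dot u (phi n)| ^+ 2)%:E)%E.

Definition Hp (p : R) u : Prop := (Hp_sqnorm p u < +oo)%E.

Definition Hp_norm (p : R) u : R := Num.sqrt (fine (Hp_sqnorm p u)).

Definition S_set (rho p : R) u : Prop := Hp p u /\ Hp_norm p u <= rho.

Definition unique_solution (w g : L2 Omega) : Prop :=
  L2eq (T_op g) w /\ forall g', L2eq (T_op g') w -> L2eq g' g.

End problem.

(* Main.v *)
(** On each eigenmode, Hoelder interpolates g_n^2 between lam_n^(2p) g_n^2 and
    lam_n^(-4) g_n^2, with weights 2/(p+2) and p/(p+2).  The lower bound on
    E_{alpha,1} makes lam_n^(-2) |g_n| at most C3 times the n-th coefficient of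
    T g, so by Bessel's inequality the second factor is controlled by the norm
    of T g.  The constant C3 is positive only because the Euler integral defining
    Gamma (1 - alpha) is finite: an infinite integral would be read as 0. *)

Require Import Defs.
From mathcomp Require Import all_boot all_order all_algebra.
From mathcomp Require Import all_classical all_reals all_analysis.
From mathcomp Require Import measurable_realfun.

Import Order.TTheory GRing.Theory Num.Theory.
Import numFieldNormedType.Exports.
Local Open Scope classical_set_scope.
Local Open Scope ring_scope.

Set Implicit Arguments.
Unset Strict Implicit.

(** * Finiteness and positivity of Euler's integral on (0, 1] *)

Section Gamma_pos.
Context (R : realType).
Local Notation mu := (@lebesgue_measure R).
Implicit Types x t : R.

Let f x t := t `^ (x - 1) * expR (- t).

Lemma measurable_Gamma_integrand x D : measurable_fun D (f x).
Proof.
apply: measurable_funTS; apply: measurable_funM.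
  exact: (@measurableT_comp _ _ _ _ _ _ (@powR R ^~ (x - 1))).
exact: measurableT_comp.
Qed.

Lemma integral_powR01 x : 0 < x ->
  (\int[mu]_(t in `]0%R, 1%R]) (t `^ (x - 1))%:E <= (x^-1)%:E)%E.
Proof.
move=> x0.
have mp D : measurable_fun D (fun t => (t `^ (x - 1))%:E).
  by apply: measurable_funTS; apply/measurable_EFinP;
    exact: (@measurableT_comp _ _ _ _ _ _ (@powR R ^~ (x - 1))).
(* Starting at 1/2 rather than 1 keeps every interval nondegenerate, as the fundamental theorem of
   calculus requires. *)
pose F n : set R := `[n.+2%:R^-1, 1]%classic.
have F0 n t : F n t -> 0 < t.
  by rewrite /F/= in_itv/= => /andP[+ _]; by apply: lt_le_trans; rewrite invr_gt0.
have UF : `]0%R, 1%R]%classic = \bigcup_n F n.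
  apply/seteqP; split => t.
    rewrite /= in_itv/= => /andP[t0 t1].
    have [k _ /(_ k (leqnn k)) /= kt] := near_infty_natSinv_lt (PosNum t0).
    exists k => //; rewrite /F/= in_itv/= t1 andbT (le_trans _ (ltW kt))//.
    by rewrite lef_pV2 ?posrE// ler_nat.
  move=> [n _] /[dup] /F0 t0; rewrite /F/= !in_itv/= t0.
  by move=> /andP[_ ->].
rewrite UF.
have ndF : nondecreasing_seq F.
  apply/nondecreasing_seqP => n; rewrite subsetEset => t.
  rewrite /F/= !in_itv/= => /andP[nt ->]; rewrite andbT (le_trans _ nt)//.
  by rewrite lef_pV2 ?posrE// ler_nat.
have cF : (\int[mu]_(t in F n) (t `^ (x - 1))%:E @[n --> \oo] -->
    \int[mu]_(t in \bigcup_n F n) (t `^ (x - 1))%:E)%E.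
  apply: ge0_nondecreasing_set_cvg_integral => [//|n|n|n t _].
  - exact: measurable_itv.
  - exact: mp.
  - by rewrite lee_fin powR_ge0.
move/cvg_lim : (cF) => <- //.
apply: lime_le; first by apply/cvg_ex; eexists; exact: cF.
apply: nearW => n.
have n1 : n.+2%:R^-1 < 1 :> R by rewrite invf_lt1// ltr1n.
have n0 : 0 < n.+2%:R^-1 :> R by rewrite invr_gt0.
have cp a t : 0 < t -> {for t, continuous (fun t => t `^ a)}.
  move=> t0; apply: differentiable_continuous; apply/derivable1_diffP.
  by apply: derivable_powR; rewrite in_itv/= t0.
pose G t := x^-1 * t `^ x.
have cG t : 0 < t -> {for t, continuous G}.
  by move=> t0; apply: cvgM; [exact: cvg_cst|exact: cp].
have dG t : 0 < t -> is_derive t 1 G (t `^ (x - 1)).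
  move=> t0; have -> : t `^ (x - 1) = x^-1 *: (x * t `^ (x - 1)).
    by rewrite /GRing.scale/= mulKf// gt_eqF.
  by apply: is_deriveZ; exact: is_derive1_powR.
rewrite (@continuous_FTC2 _ _ G)//.
- by rewrite /G powR1 mulr1 -EFinB lee_fin gerBl mulr_ge0 ?powR_ge0// invr_ge0 ltW.
- apply: continuous_in_subspaceT => t; rewrite inE => /F0; exact: cp.
- split.
  + move=> t; rewrite in_itv/= => /andP[nt _].
    by have [] := dG t (lt_trans n0 nt).
  + by apply: cvg_at_right_filter; exact: cG.
  + by apply: cvg_at_left_filter; exact: cG.
- move=> t; rewrite in_itv/= => /andP[nt _].
  by rewrite derive1E; have [_ ->] := dG t (lt_trans n0 nt).
Qed.

(** On (0, 1] the exponential is at most 1, leaving the integral of the power; beyond 1 the power is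
    at most 1 because [x <= 1], leaving an exponential tail. *)
Lemma integral_Gamma_lty x : 0 < x <= 1 ->
  (\int[mu]_(t in `]0%R, +oo[) (f x t)%:E < +oo)%E.
Proof.
move=> /andP[x0 x1].
have f0 t : 0 <= f x t by rewrite mulr_ge0 ?powR_ge0 ?expR_ge0.
have -> : `]0%R, +oo[%classic = `]0%R, 1%R] `|` `]1%R, +oo[ :> set R.
  by rewrite -itv_bndbnd_setU// bnd_simp.
rewrite ge0_integral_setU//=; last 3 first.
- by apply/measurable_EFinP; exact: measurable_Gamma_integrand.
- by move=> t _; rewrite lee_fin.
- apply/disj_setPS => t [] /=; rewrite !in_itv/= => /andP[_ t1].
  by rewrite andbT ltNge t1.
apply: lte_add_pinfty.
  apply: le_lt_trans (ltry x^-1); apply: le_trans (integral_powR01 x0).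
  apply: ge0_le_integral => //.
  - by move=> t _; rewrite lee_fin.
  - by apply/measurable_EFinP; exact: measurable_Gamma_integrand.
  - by apply/measurable_EFinP; apply: measurable_funTS;
      exact: (@measurableT_comp _ _ _ _ _ _ (@powR R ^~ (x - 1))).
  - move=> t; rewrite /= in_itv/= => /andP[t0 _].
    by rewrite lee_fin ler_piMr ?powR_ge0// -expR0 ler_expR oppr_le0 ltW.
apply: le_lt_trans (ltry 1).
(* The bound 1 is read as the total mass of the exponential law of rate 1; the integrand is extended
   by zero to compare on the whole line. *)
rewrite -(integral_exponential_pdf ltr01) integral_mkcond.
apply: ge0_le_integral => //.
- by move=> t _; apply: erestrict_ge0 => ? _; rewrite lee_fin.
- apply/(measurable_restrictT _ _).1 => //.
  by apply/measurable_EFinP; exact: measurable_Gamma_integrand.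
- by apply/measurable_EFinP; exact: measurable_exponential_pdf.
move=> t _; rewrite patchE; case: ifPn => [|_].
  rewrite inE/= in_itv/= andbT => t1.
  rewrite exponential_pdfE ?(le_trans _ (ltW t1))// lee_fin mul1r mulN1r.
  rewrite ler_piMl ?expR_ge0// -[leRHS](powRr0 t); apply: ler_powR; first exact: ltW.
  by rewrite subr_le0.
by rewrite lee_fin exponential_pdf_ge0.
Qed.

(** Both factors of the integrand are nonincreasing when [x <= 1], so on [1, 2] it is at least its
    value at 2. *)
Lemma Gamma_gt0 x : 0 < x <= 1 -> 0 < Gamma x.
Proof.
move=> x01; have /andP[x0 x1] := x01.
have f0 t : 0 <= f x t by rewrite mulr_ge0 ?powR_ge0 ?expR_ge0.
rewrite fine_gt0// integral_Gamma_lty// andbT.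
apply: (@lt_le_trans _ _
  (\int[mu]_(t in `[1%R, 2%R]) (cst (2 `^ (x - 1) * expR (- 2))%:E t))%E).
  rewrite integral_cst//= lebesgue_measure_itv/= lte_fin ltr1n/=.
  by rewrite -EFinB -EFinM lte_fin !mulr_gt0 ?powR_gt0 ?expR_gt0 ?subr_gt0 ?ltr1n.
apply: (@le_trans _ _ (\int[mu]_(t in `[1%R, 2%R]) (f x t)%:E)%E).
  apply: ge0_le_integral => //.
  - by move=> t _; rewrite lee_fin mulr_ge0 ?powR_ge0 ?expR_ge0.
  - by apply/measurable_EFinP; exact: measurable_Gamma_integrand.
  - move=> t; rewrite /= in_itv/= => /andP[t1 t2].
    have t0 : 0 < t := lt_le_trans ltr01 t1.
    rewrite lee_fin ler_pM ?powR_ge0 ?expR_ge0 ?ler_expR ?lerN2//.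
    rewrite -(opprB 1) !powRN lef_pV2 ?posrE ?powR_gt0//.
    by apply: ge0_ler_powR; rewrite ?nnegrE ?subr_ge0// ltW.
apply: ge0_subset_integral => //.
- by apply/measurable_EFinP; exact: measurable_Gamma_integrand.
- by move=> t _; rewrite lee_fin.
- by move=> t; rewrite /= !in_itv/= andbT => /andP[+ _]; exact: lt_le_trans.
Qed.

End Gamma_pos.

(** * Inner product, Bessel's inequality and orthonormal series in L^2 *)

Section L2_inner_product.
Context (R : realType) (d : nat) (Omega : smooth_domain R d).
Implicit Types (u v w : L2 Omega) (phi : nat -> L2 Omega).

Local Notation mu := (dom_measure Omega).

Lemma integrable_L2mul u v :
  mu.-integrable setT (EFin \o (fun x => u x * v x)).
Proof. by apply/Lfun1_integrable; apply: Lfun2_mul_Lfun1; exact: LfunP. Qed.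

Lemma L2dotC u v : L2dot u v = L2dot v u.
Proof. by apply: eq_Rintegral => x _; rewrite mulrC. Qed.

Lemma L2dotDl u v w : L2dot (u + v) w = L2dot u w + L2dot v w.
Proof.
rewrite /L2dot -RintegralD//; [|exact: integrable_L2mul..].
by apply: eq_Rintegral => x _; rewrite -mulrDl.
Qed.

Lemma L2dotZl a u v : L2dot (a *: u) v = a * L2dot u v.
Proof.
rewrite /L2dot -RintegralZl//; last exact: integrable_L2mul.
by apply: eq_Rintegral => x _; rewrite mulrA.
Qed.

Lemma L2dotNl u v : L2dot (- u) v = - L2dot u v.
Proof. by rewrite -scaleN1r L2dotZl mulN1r. Qed.

Lemma L2dotBl u v w : L2dot (u - v) w = L2dot u w - L2dot v w.
Proof. by rewrite L2dotDl L2dotNl. Qed.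

Lemma L2dot0l u : L2dot 0 u = 0.
Proof. by rewrite -(scale0r 0) L2dotZl mul0r. Qed.

Lemma L2dot_suml n (s : 'I_n -> L2 Omega) u :
  L2dot (\sum_(i < n) s i) u = \sum_(i < n) L2dot (s i) u.
Proof.
elim/big_ind2 : _ => [|x1 x2 y1 y2 <- <-|//]; first exact: L2dot0l.
exact: L2dotDl.
Qed.

Lemma L2dot_ge0 u : 0 <= L2dot u u.
Proof. by apply: Rintegral_ge0 => x _; rewrite -expr2 sqr_ge0. Qed.

Lemma L2norm_ge0 u : 0 <= L2norm u.
Proof. by rewrite fine_ge0// Lnorm_ge0. Qed.

Lemma sqr_L2norm u : L2norm u ^+ 2 = L2dot u u.
Proof.
rewrite /L2dot /Rintegral -powR_mulrn ?L2norm_ge0// /L2norm.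
rewrite -[LHS]/(fine (_%:E)) -poweR_EFin fineK; last first.
  by rewrite ge0_fin_numE ?Lnorm_ge0//; exact: Lfunction_finite.
rewrite powR_Lnorm ?pnatr_eq0//; congr fine; apply: eq_integral => x _ /=.
by rewrite powR_mulrn// real_normK// num_real.
Qed.

Lemma ler_L2normD u v : L2norm (u + v) <= L2norm u + L2norm v.
Proof. exact: ler_LnormD. Qed.

Lemma L2normN u : L2norm (- u) = L2norm u.
Proof. exact: LnormrN. Qed.

Lemma L2eq_norm u v : L2eq u v -> L2norm u = L2norm v.
Proof.
move=> uv; apply/eqP; rewrite -(@eqrXn2 _ 2) ?L2norm_ge0// !sqr_L2norm.
apply/eqP; congr fine; apply: ae_eq_integral => //.
- by have /integrableP[] := integrable_L2mul u u.
- by have /integrableP[] := integrable_L2mul v v.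
- by apply: filterS uv => x /(_ I) + _ => ->.
Qed.

Lemma L2norm0 : L2norm (0 : L2 Omega) = 0.
Proof. by apply/eqP; rewrite -sqrf_eq0 sqr_L2norm L2dot0l. Qed.

Definition orthonormal phi :=
  forall m n, L2dot (phi m) (phi n) = (m == n)%:R.

Lemma L2dot_sum_orthonormal phi (c : nat -> R) N n : orthonormal phi ->
  L2dot (\sum_(i < N) c i *: phi i) (phi n) = if (n < N)%N then c n else 0.
Proof.
move=> on; rewrite L2dot_suml; under eq_bigr do rewrite L2dotZl on.
case: ltnP => [nN|Nn].
  rewrite (bigD1 (Ordinal nN))//= eqxx mulr1 big1 ?addr0// => i /eqP iN.
  by case: eqP => [ni|_]; [case: iN; exact: val_inj|rewrite mulr0].
by rewrite big1// => i _; rewrite ltn_eqF ?mulr0// (leq_trans (ltn_ord i)).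
Qed.

Lemma sqr_L2norm_sum_orthonormal phi (c : nat -> R) N : orthonormal phi ->
  L2norm (\sum_(i < N) c i *: phi i) ^+ 2 = \sum_(i < N) c i ^+ 2.
Proof.
move=> on; rewrite sqr_L2norm {1}L2dot_suml; apply: eq_bigr => i _.
by rewrite L2dotZl L2dotC L2dot_sum_orthonormal// ltn_ord expr2.
Qed.

(** Expand [0 <= L2dot (u - s) (u - s)] for the projection [s]: both [L2dot u s] and [L2dot s s]
    equal the sum of squared coefficients. *)
Lemma L2_bessel phi u N : orthonormal phi ->
  \sum_(i < N) L2dot u (phi i) ^+ 2 <= L2norm u ^+ 2.
Proof.
move=> on; set s := \sum_(i < N) L2dot u (phi i) *: phi i.
have us : L2dot u s = \sum_(i < N) L2dot u (phi i) ^+ 2.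
  by rewrite L2dotC L2dot_suml; apply: eq_bigr => i _; rewrite L2dotZl L2dotC.
have := L2dot_ge0 (u - s).
rewrite L2dotBl !(L2dotC _ (u - s)) !L2dotBl (L2dotC s u) us.
have ss : L2dot s s = \sum_(i < N) L2dot u (phi i) ^+ 2.
  by rewrite -sqr_L2norm; exact: (sqr_L2norm_sum_orthonormal (fun i => L2dot u (phi i))).
by rewrite ss subrr subr0 subr_ge0 sqr_L2norm.
Qed.

(** Taking the n-th coefficient is continuous for the norm, and it equals [c n] on every partial sum
    of more than n terms. *)
Lemma L2has_sum_coef phi (c : nat -> R) u n : orthonormal phi ->
  L2has_sum (fun i => c i *: phi i) u -> L2dot u (phi n) = c n.
Proof.
move=> on su.
suff : c n - L2dot u (phi n) @[k --> \oo] --> (0 : R).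
  move=> /(cvg_unique _ (cvg_cst _))-/(_ (@Rhausdorff R))/subr0_eq.
  exact: esym.
apply/norm_cvg0P; apply: (@squeeze_cvgr _ _ _ _ (cst 0)
  (fun k => L2norm (\sum_(i < k) c i *: phi i - u))) => //; last exact: cvg_cst.
near=> k; rewrite normr_ge0/=.
rewrite -(@ler_pXn2r _ 2) ?nnegrE ?L2norm_ge0// real_normK ?num_real//.
(* Bessel with n+1 terms, of which only the last one is kept. *)
apply: le_trans (L2_bessel (\sum_(i < k) c i *: phi i - u) n.+1 on).
rewrite big_ord_recr/= L2dotBl L2dot_sum_orthonormal// ifT; last first.
  by near: k; exists n.+1.
by rewrite lerDr sumr_ge0// => i _; rewrite sqr_ge0.
Unshelve. all: by end_near. Qed.

(** By Pythagoras every partial sum has norm at most [K]; the triangle inequality carries the bound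
    to the limit. *)
Lemma L2has_sum_norm_le phi (c : nat -> R) u (K : R) : orthonormal phi ->
  L2has_sum (fun i => c i *: phi i) u ->
  0 <= K -> (forall N, \sum_(i < N) c i ^+ 2 <= K ^+ 2) -> L2norm u <= K.
Proof.
move=> on su K0 cK.
have : L2norm (\sum_(i < k) c i *: phi i - u) + K @[k --> \oo] --> 0 + K.
  by apply: cvgD => //; exact: cvg_cst.
rewrite add0r => /cvgr_to_ge; apply; near=> k.
set S := \sum_(i < k) c i *: phi i.
rewrite -{1}(subKr S u) addrC (le_trans (ler_L2normD _ _))// L2normN lerD2l.
rewrite -(@ler_pXn2r _ 2) ?nnegrE ?L2norm_ge0//.
by rewrite sqr_L2norm_sum_orthonormal.
Unshelve. all: by end_near. Qed.

Lemma L2has_sum_sqr_le phi (c : nat -> R) u N : orthonormal phi ->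
  L2has_sum (fun i => c i *: phi i) u ->
  \sum_(i < N) c i ^+ 2 <= L2norm u ^+ 2.
Proof.
move=> on su; apply: le_trans (L2_bessel u N on).
by apply: ler_sum => i _; rewrite (L2has_sum_coef i on su).
Qed.

(** Separates genuine convergence from the default value of [xget], since the definition of [T_op]
    does not by itself ensure convergence. *)
Lemma L2sumP (s : nat -> L2 Omega) :
  L2has_sum s (L2sum s) \/ L2sum s = 0.
Proof.
rewrite /L2sum; case: xgetP => [x _ sx|_]; [by left|by right].
Qed.

End L2_inner_product.

(** * Hölder's inequality for finite sums and the interpolation exponents *)

Lemma hoelder_sum (R : realType) (a b : nat -> R) (r s : R) N :
  0 < r -> 0 < s -> r + s = 1 ->
  (forall n, 0 <= a n) -> (forall n, 0 <= b n) ->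
  \sum_(n < N) a n `^ r * b n `^ s
    <= (\sum_(n < N) a n) `^ r * (\sum_(n < N) b n) `^ s.
Proof.
move=> r0 s0 rs a0 b0; elim: N => [|N IH].
  by rewrite !big_ord0 powR0 ?gt_eqF// mul0r.
have powK t x : 0 < t -> 0 <= x -> (x `^ t) `^ t^-1 = x :> R.
  by move=> t0 x0; rewrite -powRrM mulfV ?gt_eqF// powRr1.
have A0 : 0 <= \sum_(n < N) a n by apply: sumr_ge0.
have B0 : 0 <= \sum_(n < N) b n by apply: sumr_ge0.
rewrite !big_ord_recr/= (le_trans (lerD IH (lexx _)))//.
(* Two-term Hölder with conjugate exponents 1/r and 1/s absorbs the new term: these exponents undo
   the powers [r] and [s] and restore the partial sums. *)
have := @hoelder2 R ((\sum_(n < N) a n) `^ r) (a N `^ r)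
  ((\sum_(n < N) b n) `^ s) (b N `^ s) r^-1 s^-1.
by rewrite !powK// !invrK; apply; rewrite ?powR_ge0 ?invr_gt0.
Qed.

(** The weights sum to 1, so [x] survives to the first power, and they balance the powers of [l]: 2p
    * 2/(p+2) = 4 * p/(p+2). *)
Lemma powR_interpolation (R : realType) (l x p : R) : 0 < l -> 0 <= x -> 0 < p ->
  (l `^ (2 * p) * x) `^ (2 / (p + 2)) * ((l ^- 2) ^+ 2 * x) `^ (p / (p + 2)) = x.
Proof.
move=> l0 x0 p0; have p2 : p + 2 != 0 by rewrite gt_eqF// addr_gt0.
have -> : (l ^- 2) ^+ 2 = l `^ (- 4%:R).
  by rewrite powR_invn ?(ltW l0)// exprVn -exprM.
rewrite !powRM ?powR_ge0//.
rewrite mulrACA -(powRrM l (2 * p)).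
rewrite -powRrM -powRD; last by rewrite (gt_eqF l0) implybT.
rewrite -powRD; last first.
  by rewrite -mulrDl addrC divff// oner_eq0.
have -> : 2 / (p + 2) + p / (p + 2) = 1 by rewrite -mulrDl addrC divff.
have -> : 2 * p * (2 / (p + 2)) + - 4%:R * (p / (p + 2)) = 0.
  rewrite !mulrA -mulrDl [2 * p * 2]mulrAC -natrM mulNr subrr mul0r//.
by rewrite powRr0 powRr1// mul1r.
Qed.

(** * The stability constant and the interpolation estimate *)

Section stability.
Context (R : realType).

Definition stability_constant (alpha tau lambda1 C1 : R) : R :=
  (lambda1 ^- 2 + tau `^ alpha) * Gamma (1 - alpha) / C1.

Lemma stability_constant_gt0 (alpha tau lambda1 C1 : R) : 0 < alpha < 1 ->
  0 < lambda1 -> 0 < C1 -> 0 < stability_constant alpha tau lambda1 C1.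
Proof.
move=> /andP[a0 a1] l0 C0; rewrite divr_gt0// mulr_gt0//.
  by rewrite ltr_pwDl ?powR_ge0// invr_gt0 exprn_gt0.
by rewrite Gamma_gt0// subr_gt0 a1 gerBl ltW.
Qed.

Lemma inv_sqr_le_mittag_leffler (alpha tau lambda1 C1 l : R) :
    0 < alpha < 1 -> 0 < lambda1 <= l -> 0 < C1 ->
    (forall x : R, x <= 0 ->
       C1 / Gamma (1 - alpha) * (1 / (1 - x)) <= mittag_leffler alpha 1 x) ->
  l ^- 2 <= stability_constant alpha tau lambda1 C1
            * mittag_leffler alpha 1 (- l ^+ 2 * tau `^ alpha).
Proof.
move=> a01 /andP[l10 l1l] C0 hML; have l0 := lt_le_trans l10 l1l.
have K0 := stability_constant_gt0 tau a01 l10 C0.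
have G0 : 0 < Gamma (1 - alpha).
  by case/andP: a01 => a0 a1; rewrite Gamma_gt0// subr_gt0 a1 gerBl ltW.
have T0 : 0 <= tau `^ alpha := powR_ge0 _ _.
have x0 : - l ^+ 2 * tau `^ alpha <= 0 by rewrite mulNr oppr_le0 mulr_ge0// sqr_ge0.
apply: (le_trans _ (ler_wpM2l (ltW K0) (hML _ x0))).
rewrite /stability_constant mulNr opprK mul1r !mulrA divfK ?gt_eqF//.
rewrite mulfK ?gt_eqF// ler_pdivlMr; last first.
  exact: ltr_pwDl ltr01 (mulr_ge0 (sqr_ge0 _) T0).
rewrite mulrDr mulr1 mulrA mulVf ?gt_eqF ?exprn_gt0// mul1r lerD2r.
by rewrite lef_pV2 ?posrE ?exprn_gt0// ler_pXn2r// nnegrE ltW.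
Qed.

Context (d : nat) (Omega : smooth_domain R d).
Implicit Types (lam c : nat -> R) (phi : nat -> L2 Omega).

(** Membership in [Hp] makes [fine] faithful: an infinite series would be read as norm 0.
    Nonnegative terms then bound partial sums by the whole. *)
Lemma sum_le_Hp_sqnorm lam phi p (u : L2 Omega) N : Hp lam phi p u ->
  \sum_(n < N) lam n `^ (2 * p) * L2dot u (phi n) ^+ 2 <= Hp_norm lam phi p u ^+ 2.
Proof.
move=> Hu.
have H0 : (0 <= Hp_sqnorm lam phi p u)%E.
  by apply: nneseries_ge0 => n _ _; rewrite lee_fin mulr_ge0 ?powR_ge0 ?sqr_ge0.
rewrite sqr_sqrtr ?fine_ge0// -lee_fin fineK ?ge0_fin_numE//.
rewrite -sumEFin; apply: le_trans (nneseries_lim_ge N _).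
  rewrite big_mkord; apply: lee_sum => n _.
  by rewrite lee_fin real_normK ?num_real.
by move=> n _; rewrite lee_fin mulr_ge0 ?powR_ge0 ?sqr_ge0.
Qed.

(** Here [c] is an abstract multiplier standing for the Mittag-Leffler values, and [w] stands for T
    u. *)
Lemma L2norm_interpolation lam phi c (K p : R) (u w : L2 Omega) :
    0 < p -> 0 <= K -> orthonormal phi ->
    L2has_sum (fun n => L2dot u (phi n) *: phi n) u ->
    L2has_sum (fun n => (c n * L2dot u (phi n)) *: phi n) w ->
    (forall n, 0 < lam n) -> (forall n, lam n ^- 2 <= K * c n) ->
    Hp lam phi p u ->
  L2norm u <= K `^ (p / (p + 2)) * Hp_norm lam phi p u `^ (2 / (p + 2))
              * L2norm w `^ (p / (p + 2)).
Proof.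
move=> p0 K0 on su sw lam0 lamK Hu.
have p20 : 0 < p + 2 by rewrite addr_gt0.
set r := 2 / (p + 2); set s := p / (p + 2).
have rs : r + s = 1 by rewrite -mulrDl addrC divff ?gt_eqF.
have r0 : 0 < r by rewrite divr_gt0.
have s0 : 0 < s by rewrite divr_gt0.
have H0 : 0 <= Hp_norm lam phi p u := sqrtr_ge0 _.
have W0 := L2norm_ge0 w.
apply: (L2has_sum_norm_le on su) => [|N].
  by rewrite !mulr_ge0 ?powR_ge0.
have sqr_powR (x t : R) : 0 <= x -> (x `^ t) ^+ 2 = (x ^+ 2) `^ t.
  by move=> x0; rewrite -!powR_mulrn ?powR_ge0// powRAC.
(* The squared bound is regrouped as the squared [Hp_norm] to the power [r] times the square of
   [K * L2norm w] to the power [s], the shape of Hölder's right-hand side. *)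
rewrite !exprMn !sqr_powR// mulrAC -powRM ?sqr_ge0// -exprMn mulrC.
pose a n := lam n `^ (2 * p) * L2dot u (phi n) ^+ 2.
pose b n := K ^+ 2 * (c n * L2dot u (phi n)) ^+ 2.
have a0 n : 0 <= a n by rewrite mulr_ge0 ?powR_ge0 ?sqr_ge0.
have b0 n : 0 <= b n by rewrite mulr_ge0 ?sqr_ge0.
apply: (@le_trans _ _ (\sum_(n < N) a n `^ r * b n `^ s)).
  apply: ler_sum => n _.
  (* Each squared coefficient is split so that the first factor is exactly [a n]^
     r[; the hypothesis on]K * c n[bounds the second by]b n [^ s]. *)
  rewrite -[leLHS](powR_interpolation (lam0 n) _ p0) ?sqr_ge0//.
  apply: ler_wpM2l; first exact: powR_ge0.
  apply: ge0_ler_powR; [exact: ltW| |exact: b0|].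
    by apply: mulr_ge0; exact: sqr_ge0.
  have -> : b n = (K * c n) ^+ 2 * L2dot u (phi n) ^+ 2.
    by rewrite /b !exprMn mulrA.
  rewrite ler_wpM2r ?sqr_ge0//.
  have l2 : 0 <= lam n ^- 2 by rewrite invr_ge0 sqr_ge0.
  by rewrite ler_pXn2r ?nnegrE ?(le_trans l2 (lamK n)).
apply: (le_trans (hoelder_sum N r0 s0 rs a0 b0)).
have A0 : 0 <= \sum_(n < N) a n by apply: sumr_ge0.
have B0 : 0 <= \sum_(n < N) b n by apply: sumr_ge0.
apply: ler_pM; rewrite ?powR_ge0//; apply: ge0_ler_powR;
  rewrite ?nnegrE ?sqr_ge0 ?(ltW r0) ?(ltW s0)//.
  exact: sum_le_Hp_sqnorm.
rewrite -mulr_sumr exprMn ler_wpM2l ?sqr_ge0//.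
exact: (L2has_sum_sqr_le _ on sw).
Qed.

End stability.

(** * The conditional stability estimate *)

Unset Implicit Arguments.

Theorem theorem3p10 (R : realType) (alpha tau lambda1 C1 : R)
    (halpha : 0 < alpha < 1) (htau : 0 < tau)
    (hlambda1 : 0 < lambda1) (hC1 : 0 < C1)
    (hML : forall x : R, x <= 0 ->
       C1 / Gamma (1 - alpha) * (1 / (1 - x)) <= mittag_leffler alpha 1 x) :
  exists C3 : R, 0 < C3 /\
    forall (d : nat) (hd : (1 <= d <= 7)%N) (Omega : smooth_domain R d)
      (lam : nat -> R) (phi : nat -> L2 Omega)
      (hspec : dirichlet_spectrum lam phi) (hlam : lam 0%N = lambda1)
      (h : L2 Omega) (f : R -> L2 Omega) (hf : Linfty_L2 tau f)
      (g : L2 Omega)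
      (hg : unique_solution alpha tau lam phi
              (Upsilon alpha tau lam phi h f) g)
      (rho p : R) (hrho : 0 < rho) (hp : 0 < p)
      (hS : S_set lam phi rho p g),
    L2norm g <=
      C3 `^ (p / (p + 2)) * Hp_norm lam phi p g `^ (2 / (p + 2))
      * L2norm (Upsilon alpha tau lam phi h f) `^ (p / (p + 2)).
Proof.
have C30 := stability_constant_gt0 tau halpha hlambda1 hC1.
(* The witness is fixed before the domain, the data and [p] are introduced. *)
exists (stability_constant alpha tau lambda1 C1); split=> //.
move=> d _ Omega lam phi [[lam00 _ lam_homo _] [_ _ _ [on complete]]] lam0.
move=> h f _ g [Tg uniq_g] rho p _ p0 [Hpg _].
have lam1 n : lambda1 <= lam n by rewrite -lam0; exact: lam_homo.
(* The right-hand side now involves T g, whose coefficients are explicit multiples of those of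
   [g]. *)
rewrite -(L2eq_norm Tg).
have [sTg|Tg0] := L2sumP (fun n => (mittag_leffler alpha 1
    (- lam n ^+ 2 * tau `^ alpha) * L2dot g (phi n)) *: phi n).
- apply: L2norm_interpolation p0 (ltW C30) on (complete g) sTg _ _ Hpg => n.
  + exact: lt_le_trans (lam1 n).
  + by apply: inv_sqr_le_mittag_leffler => //; rewrite hlambda1 lam1.
- (* If the series defining [T_op g] diverges, [T_op g] takes the junk value 0,
     so 0 solves the same equation as [g] and uniqueness forces g = 0. *)
  have T0 : L2norm (T_op alpha tau lam phi (0 : L2 Omega)) = 0.
    rewrite /T_op; have [sT0|->] := L2sumP (fun n => (mittag_leffler
      alpha 1 (- lam n ^+ 2 * tau `^ alpha) * L2dot 0 (phi n)) *: phi n).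
    + apply/eqP; rewrite eq_le L2norm_ge0 andbT.
      apply: (L2has_sum_norm_le on sT0) => // N.
      by rewrite big1 ?expr0n// => n _; rewrite L2dot0l mulr0 expr0n.
    + exact: L2norm0.
  have g0 : L2eq 0 g.
    apply: uniq_g; apply: ae_eq_trans Tg; rewrite /T_op Tg0.
    (* A vanishing norm yields equality almost everywhere, the sense in which uniqueness is
       stated. *)
    exact: fine_Lnormr_eq0 T0.
  by rewrite -(L2eq_norm g0) L2norm0 !mulr_ge0 ?powR_ge0.
Qed.
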